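(* Let $a\in\mathbb C$, $a\neq 0$, and let $F_{aI}=\begin{bmatrix} S^* & aI\\ 0 & S\end{bmatrix}$ acting on $\mathcal H\oplus\mathcal H$. Then the numerical range $W(F_{aI})$ is not an elliptical disk.
   Context: $\mathcal H$ is a Hilbert space and $S$ is the (unilateral) right shift on $\mathcal H$, i.e. $Se_n=e_{n+1}$ for an orthonormal basis $(e_n)_{n\ge 0}$ of $\mathcal H$; $S^*$ is its adjoint and $I$ the identity. The numerical range of a bounded linear operator $A$ on a Hilbert space is $W(A)=\{\langle Ax,x\rangle: \|x\|=1\}\subset\mathbb C$. An elliptical disk is the region of the plane $\mathbb C\cong\mathbb R^2$ bounded by an ellipse (circles included). *)

(* Defs.v *)
From HB Require Import structures.
From mathcomp Require Import all_boot all_order all_algebra.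
From mathcomp Require Import all_classical all_reals all_analysis.
From mathcomp Require Import complex.

Set Implicit Arguments.
Unset Strict Implicit.
Unset Printing Implicit Defensive.

Import Order.TTheory GRing.Theory Num.Theory.
Import numFieldNormedType.Exports.

Local Open Scope classical_set_scope.
Local Open Scope ring_scope.

(* Inner products are linear in the first argument and conjugate-linear in
   the second. *)
Section InnerProduct.
Variables (C : numClosedFieldType) (V : lmodType C).
Variable ip : {dot V for Num.conj}.

Definition ip_norm (x : V) : C := sqrtC (ip x x).

(* Positive definiteness of ip makes such a B unique. *)
Definition is_adjoint (A B : V -> V) : Prop :=
  forall x y : V, ip (A x) y = ip x (B y).

Definition numerical_range (A : V -> V) : set C :=
  [set ip (A x) x | x in [set x | ip_norm x = 1]].

End InnerProduct.

(* The library's norm on the product V * W is the maximum of the norms, so the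
   Hilbert direct sum is the product module equipped with this inner product
   and not with the library's norm. *)
Section DirectSum.
Variables (C : numClosedFieldType) (V W : lmodType C).
Variables (ipV : {dot V for Num.conj}) (ipW : {dot W for Num.conj}).

Definition dsum_ip (x y : V * W) : C := ipV x.1 y.1 + ipW x.2 y.2.

Fact dsum_ip_zmod_morphisml y : zmod_morphism (dsum_ip ^~ y).
Proof. by move=> u v; rewrite /dsum_ip /= !linearBl opprD addrACA. Qed.

Fact dsum_ip_zmod_morphismr x : zmod_morphism (dsum_ip x).
Proof. by move=> u v; rewrite /dsum_ip /= !linearBr opprD addrACA. Qed.

Fact dsum_ip_linearl y : scalable_for *%R (dsum_ip ^~ y).
Proof. by move=> c u; rewrite /dsum_ip /= !linearZl_LR /= mulrDr. Qed.

Fact dsum_ip_linearr x : scalable_for (Num.conj \; *%R) (dsum_ip x).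
Proof. by move=> c u; rewrite /dsum_ip /= !linearZr_LR /= mulrDr. Qed.

HB.instance Definition _ := @isBilinear.Build C (V * W)%type (V * W)%type C
  *%R (Num.conj \; *%R) dsum_ip dsum_ip_zmod_morphisml dsum_ip_zmod_morphismr
  dsum_ip_linearl dsum_ip_linearr.

Fact dsum_ip_hermitian x y :
  dsum_ip x y = (-1) ^+ false * Num.conj (dsum_ip y x).
Proof.
rewrite /dsum_ip expr0 mul1r rmorphD /=; congr (_ + _);
by rewrite [LHS]hermitian_subproof expr0 mul1r.
Qed.

HB.instance Definition _ := @isHermitianSesquilinear.Build C (V * W)%type
  false Num.conj dsum_ip dsum_ip_hermitian.

Fact dsum_ip_gt0 x : x != 0 -> 0 < dsum_ip x x.
Proof.
case: x => v w; rewrite /dsum_ip /=; have [-> | v0 _] := eqVneq v 0.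
  have [-> /eqP // | w0 _] := eqVneq w 0.
  by rewrite ltr_wpDl ?dnorm_ge0 ?dnorm_gt0.
by rewrite ltr_wpDr ?dnorm_ge0 ?dnorm_gt0.
Qed.

HB.instance Definition _ := @isDotProduct.Build C (V * W)%type dsum_ip
  dsum_ip_gt0.

End DirectSum.

Section Hilbert.
Variables (R : realType) (H : normedModType R[i]).
Variable ip : {dot H for Num.conj}.

Definition is_orthonormal_basis (e : nat -> H) : Prop :=
  (forall m n : nat, ip (e m) (e n) = (m == n)%:R) /\
  closure [set x : H | exists (n : nat) (c : nat -> R[i]),
                         x = \sum_(k < n) c k *: e k] = [set: H].

End Hilbert.

(* The operator [[Ss, T], [0, S]] on H (+) H, where Ss stands for S^*. *)
Definition foguel (C : numClosedFieldType) (H : lmodType C)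
    (S Ss T : H -> H) (x : H * H) : H * H :=
  (Ss x.1 + T x.2, S x.2).

(* The ellipse with foci f1, f2 and major axis of length l is
   {z | |z - f1| + |z - f2| = l}, nondegenerate when |f1 - f2| < l; circles are
   the case f1 = f2.  An elliptical disk may contain all, part or none of its
   boundary ellipse. *)
Definition is_elliptical_disk (R : realType) (X : set R[i]) : Prop :=
  exists (f1 f2 : R[i]) (l : R),
    [/\ `|f1 - f2| < l%:C%C,
        [set z | `|z - f1| + `|z - f2| < l%:C%C] `<=` X &
        X `<=` [set z | `|z - f1| + `|z - f2| <= l%:C%C]].

(* Main.v *)
(* Put r = |a| / 2.  Testing on the vectors (p E, q E), E = e_0 + ... + e_n,
   shows that the circles of radius r about 1 - 1/(n+1) lie in W(F), so the
   circle of radius r about 1 lies in its closure.  Conversely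
   Re (conj w z) <= Re w + r on W(F) for every unit w = c + i s with c > 0 and
   s^2 <= r c, so near w = 1 the points 1 + r w of that circle are boundary
   points of W(F).  If W(F) were an elliptical disk, its boundary ellipse would
   share an arc with this circle, hence be equal to it; but -r lies in W(F). *)

Require Import Defs.
From mathcomp Require Import all_boot all_order all_algebra.
From mathcomp Require Import all_classical all_reals all_analysis.
From mathcomp Require Import complex ring lra.

Set Implicit Arguments.
Unset Strict Implicit.
Unset Printing Implicit Defensive.

Import Order.TTheory GRing.Theory Num.Theory.
Import ComplexField.Normc.
Import numFieldNormedType.Exports.

Local Open Scope classical_set_scope.
Local Open Scope ring_scope.

(** * Trigonometric polynomials on an arc of the unit circle *)

Lemma quadratic_three_roots (K : fieldType) (p q r x y z : K) :
  x != y -> y != z -> x != z ->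
  p * x ^+ 2 + q * x + r = 0 -> p * y ^+ 2 + q * y + r = 0 ->
  p * z ^+ 2 + q * z + r = 0 -> p = 0 /\ q = 0.
Proof.
rewrite -subr_eq0 -(subr_eq0 y) -(subr_eq0 x z) => xy yz xz ex ey ez.
have p0 : p = 0.
  apply: (mulIf (mulf_neq0 (mulf_neq0 xy yz) xz)); rewrite mul0r.
  (* This combination eliminates [q] and [r] and leaves [p] times the Vandermonde product. *)
  transitivity ((p * x ^+ 2 + q * x + r) * (y - z)
    - (p * y ^+ 2 + q * y + r) * (x - z)
    + (p * z ^+ 2 + q * z + r) * (x - y)); first by ring.
  by rewrite ex ey ez; ring.
split=> //; apply: (mulIf xy); rewrite mul0r -[RHS](subrr 0) -{1}ex -ey p0.
by ring.
Qed.

(** [1 - c^2 = (1 - c) (1 + c) <= 2 (1 - c)], and the lower bound on [c] amounts to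
    [2 (1 - c) <= r c]. *)
Lemma arc_point (R : rcfType) (r c : R) : 0 < r -> 2 / (2 + r) <= c < 1 ->
  [/\ 0 < c, c ^+ 2 + Num.sqrt (1 - c ^+ 2) ^+ 2 = 1,
      0 < Num.sqrt (1 - c ^+ 2) & Num.sqrt (1 - c ^+ 2) ^+ 2 <= r * c].
Proof.
move=> r0 /andP[]; rewrite ler_pdivrMr; last by lra.
move=> rc c1; have c0 : 0 < c by nra.
have d0 : 0 < 1 - c ^+ 2 by nra.
rewrite sqr_sqrtr; last exact: ltW.
split=> //; [by ring | by rewrite sqrtr_gt0 | by nra].
Qed.

(** The arc is symmetric under [s -> - s], so the parts even and odd in [s] agree separately. After
    [s^2 = 1 - c^2] the even part is a quadratic in [c] with three roots; the odd part at two of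
    them gives [C * B = 0]. *)
Lemma trig_poly_arc_eq0 (R : rcfType) (r A B C D E F : R) : 0 < r ->
  (forall c s, c ^+ 2 + s ^+ 2 = 1 -> 0 < c -> s ^+ 2 <= r * c ->
    (A + B * c + C * s) ^+ 2 = D + E * c + F * s) ->
  [/\ B = 0, C = 0, E = 0 & F = 0].
Proof.
move=> r0 arc.
have parity c s : c ^+ 2 + s ^+ 2 = 1 -> 0 < c -> s ^+ 2 <= r * c -> 0 < s ->
    (B ^+ 2 - C ^+ 2) * c ^+ 2 + (2 * A * B - E) * c + (A ^+ 2 + C ^+ 2 - D) = 0
    /\ 2 * C * (A + B * c) = F.
  move=> cs c0 sr s0; have e1 := arc c s cs c0 sr.
  have := arc c (- s); rewrite sqrrN => /(_ cs c0 sr) e2.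
  have s2 : s ^+ 2 = 1 - c ^+ 2 by rewrite -cs; ring.
  split; last by apply: (mulIf (lt0r_neq0 s0)); lra.
  have : C ^+ 2 * s ^+ 2 = C ^+ 2 * (1 - c ^+ 2) by rewrite s2.
  by lra.
(* Two values admissible for [arc_point]: [k / (k + r)] increases with [k], stays below 1, and
   equals the threshold at [k = 2]. *)
pose c1 := 4 / (4 + r); pose c2 := 8 / (8 + r).
have c12 : c1 < c2.
  rewrite ltr_pdivrMr; last by lra.
  by rewrite mulrAC ltr_pdivlMr; lra.
have c2l : c2 < 1 by rewrite ltr_pdivrMr; lra.
have c1l : c1 < 1 := lt_trans c12 c2l.
have c1b : 2 / (2 + r) <= c1 < 1.
  rewrite c1l andbT ler_pdivrMr; last by lra.
  by rewrite mulrAC ler_pdivlMr; lra.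
have c2b : 2 / (2 + r) <= c2 < 1 by rewrite c2l andbT; case/andP: c1b; lra.
have [c1p cs1 s1p s1r] := arc_point r0 c1b.
have [c2p cs2 s2p s2r] := arc_point r0 c2b.
have [ev1 od1] := parity _ _ cs1 c1p s1r s1p.
have [ev2 od2] := parity _ _ cs2 c2p s2r s2p.
(* The third root is [c = 1]. There [s = 0], so [parity] does not apply, but the odd part vanishes
   by itself. *)
have ev0 : (B ^+ 2 - C ^+ 2) * 1 ^+ 2 + (2 * A * B - E) * 1
    + (A ^+ 2 + C ^+ 2 - D) = 0.
  have e1 : (A + B * 1 + C * 0) ^+ 2 = D + E * 1 + F * 0.
    by apply: arc; [ring | exact: ltr01 | rewrite expr0n mulr1 ltW].
  by rewrite !mulr0 !addr0 in e1; lra.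
have [p0 q0] := quadratic_three_roots (negbT (lt_eqF c12))
  (negbT (lt_eqF c2l)) (negbT (lt_eqF c1l)) ev1 ev2 ev0.
have CB0 : C * B = 0.
  have d : c2 - c1 != 0 by rewrite subr_eq0 gt_eqF.
  by apply: (mulIf d); lra.
have B0 : B = 0.
  by apply/eqP; rewrite -[_ == _](expf_eq0 B 4); apply/eqP;
  transitivity (B ^+ 2 * (B ^+ 2 - C ^+ 2) + (C * B) ^+ 2); [ring|];
  rewrite p0 CB0; ring.
have C0 : C = 0.
  by apply/eqP; rewrite -[_ == _](expf_eq0 C 2); move: p0; rewrite B0; lra.
split=> //; first by move: q0; rewrite B0; lra.
by rewrite -od1 C0; ring.
Qed.

(** * Moduli of complex numbers and ellipses through the arc *)

Lemma normc_normr (R : rcfType) (z : R[i]) : `|z| = (normc z)%:C%C.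
Proof. by []. Qed.

Lemma normc_ge0 (R : rcfType) (z : R[i]) : 0 <= normc z.
Proof. by case: z => x y; rewrite sqrtr_ge0. Qed.

Lemma sqr_normcE (R : rcfType) (x y : R) :
  normc (x +i* y)%C ^+ 2 = x ^+ 2 + y ^+ 2.
Proof. by rewrite sqr_sqrtr // addr_ge0 // sqr_ge0. Qed.

Lemma normc_real (R : rcfType) (x : R) : normc x%:C%C = `|x|.
Proof. by rewrite /= expr0n addr0 sqrtr_sqr. Qed.

(* Squaring twice turns [p + q = l] into
   [(p^2 - q^2)^2 = 2 l^2 (p^2 + q^2) - l^4]; on the circle [p^2] and [q^2] are
   affine in [(c, s)]. *)
Lemma ellipse_through_arc (R : rcfType) (r l : R) (f1 f2 : R[i]) :
  0 < r -> 0 < l ->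
  (forall c s, c ^+ 2 + s ^+ 2 = 1 -> 0 < c -> s ^+ 2 <= r * c ->
    normc (1 + r%:C * (c +i* s) - f1)%C + normc (1 + r%:C * (c +i* s) - f2)%C
      = l) ->
  [/\ f1 = 1, f2 = 1 & l = 2 * r].
Proof.
case: f1 => x1 y1; case: f2 => x2 y2 r0 l0 arc.
pose n1 := (1 - x1) ^+ 2 + y1 ^+ 2; pose n2 := (1 - x2) ^+ 2 + y2 ^+ 2.
(* The first two equations make the foci coincide; the last two put their midpoint at 1. *)
have [dx dy sx sy] : [/\ 2 * r * (x2 - x1) = 0, 2 * r * (y2 - y1) = 0,
    2 * l ^+ 2 * (2 * r * (2 - x1 - x2)) = 0 &
    2 * l ^+ 2 * (- 2 * r * (y1 + y2)) = 0].
  apply: (@trig_poly_arc_eq0 _ r (n1 - n2) _ _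
    (2 * l ^+ 2 * (2 * r ^+ 2 + n1 + n2) - l ^+ 4)) => // c s cs c0 sr.
  have := arc c s cs c0 sr.
  set p := normc _; set q := normc _ => <-.
  have rcs : r ^+ 2 * c ^+ 2 + r ^+ 2 * s ^+ 2 = r ^+ 2.
    by rewrite -mulrDr cs mulr1.
  have p2 : p ^+ 2 = r ^+ 2 + n1 + 2 * r * (1 - x1) * c - 2 * r * y1 * s.
    rewrite /p; have -> : (1 + r%:C * (c +i* s) - (x1 +i* y1) =
      (1 + r * c - x1) +i* (r * s - y1))%C by simpc.
    by rewrite sqr_normcE /n1; lra.
  have q2 : q ^+ 2 = r ^+ 2 + n2 + 2 * r * (1 - x2) * c - 2 * r * y2 * s.
    rewrite /q; have -> : (1 + r%:C * (c +i* s) - (x2 +i* y2) =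
      (1 + r * c - x2) +i* (r * s - y2))%C by simpc.
    by rewrite sqr_normcE /n2; lra.
  transitivity ((p ^+ 2 - q ^+ 2) ^+ 2); first by rewrite p2 q2; ring.
  transitivity (2 * (p + q) ^+ 2 * (p ^+ 2 + q ^+ 2) - (p + q) ^+ 4).
    by ring.
  by rewrite [in LHS]p2 [in LHS]q2; ring.
have cancel2r u : 2 * r * u = 0 -> u = 0.
  by move=> h; apply: (mulfI (_ : 2 * r != 0)); rewrite ?mulr0 //; lra.
move: (cancel2r _ dx) (cancel2r _ dy) => {}dx {}dy.
have cancel2l u : 2 * l ^+ 2 * u = 0 -> u = 0.
  move=> h; apply: (mulfI (_ : 2 * l ^+ 2 != 0)); rewrite ?mulr0 //.
  by rewrite lt0r_neq0 // mulr_gt0 ?exprn_gt0 //; lra.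
move: (cancel2l _ sx) (cancel2l _ sy) => /cancel2r {}sx {}sy.
have {}sy : y1 + y2 = 0 by apply: cancel2r; lra.
have [ex1 ey1 ex2 ey2] : [/\ x1 = 1, y1 = 0, x2 = 1 & y2 = 0].
  by split; lra.
split; try by rewrite ?(ex1, ey1, ex2, ey2).
rewrite -(arc 1 0); [|ring|exact: ltr01|by rewrite expr0n mulr1 ltW].
rewrite ex1 ey1 ex2 ey2.
have -> : (1 + r%:C * (1 +i* 0) - (1 +i* 0) = r +i* 0)%C.
  by simpc; rewrite addrAC subrr add0r.
by rewrite /= expr0n addr0 sqrtr_sqr gtr0_norm //; ring.
Qed.

(** * Real part of the inner product and the support estimate *)

Section RealInnerProduct.
Variables (R : realType) (V : lmodType R[i]) (ip : {dot V for Num.conj}).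

(** Real values reduce the estimates to linear arithmetic over [R]; imaginary parts return as
    products with ['i *: y], see [rip_ir]. *)
Definition rip (x y : V) : R := complex.Re (ip x y).

Lemma conjCE (z : R[i]) : Num.conj z = (z^*)%C.
Proof. by []. Qed.

Lemma ipC x y : ip y x = Num.conj (ip x y).
Proof. by rewrite hermC expr0 mul1r. Qed.

Lemma ripC x y : rip y x = rip x y.
Proof. by rewrite /rip ipC; case: (ip x y). Qed.

Lemma ripDl x y z : rip (x + y) z = rip x z + rip y z.
Proof. by rewrite /rip linearDl raddfD. Qed.

Lemma ripDr x y z : rip z (x + y) = rip z x + rip z y.
Proof. by rewrite ripC ripDl !(ripC z). Qed.

Lemma ripZl (k : R) x y : rip (k%:C%C *: x) y = k * rip x y.
Proof. by rewrite /rip linearZl_LR /=; case: (ip x y) => u v /=; ring. Qed.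

Lemma ripZr (k : R) x y : rip x (k%:C%C *: y) = k * rip x y.
Proof. by rewrite ripC ripZl ripC. Qed.

Lemma ripNl x y : rip (- x) y = - rip x y.
Proof. by rewrite /rip linearNl raddfN. Qed.

Lemma ripNr x y : rip x (- y) = - rip x y.
Proof. by rewrite ripC ripNl ripC. Qed.

Lemma rip_ir x y : rip x ('i%C *: y) = complex.Im (ip x y).
Proof.
by rewrite /rip linearZr_LR /= conjCE; case: (ip x y) => u v /=; ring.
Qed.

Lemma rip_ii x y : rip ('i%C *: x) ('i%C *: y) = rip x y.
Proof.
by rewrite rip_ir linearZl_LR /= /rip; case: (ip x y) => u v /=; ring.
Qed.

Lemma rip_il x y : rip ('i%C *: x) y = - rip x ('i%C *: y).
Proof.
by rewrite rip_ir /rip linearZl_LR /=; case: (ip x y) => u v /=; ring.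
Qed.

Lemma ipxxE x : ip x x = (rip x x)%:C%C.
Proof. by rewrite /rip RRe_real // ger0_real ?dnorm_ge0. Qed.

Lemma rip_ge0 x : 0 <= rip x x.
Proof. by rewrite -ler0c -ipxxE dnorm_ge0. Qed.

Definition ripE := (ripDl, ripDr, ripNl, ripNr, ripZl, ripZr, rip_ii, rip_il).

(** Polarization: compare the cross terms in the squared norm of [x + y]. *)
Lemma isometry_rip (T : {linear V -> V}) :
  (forall x, rip (T x) (T x) = rip x x) ->
  forall x y, rip (T x) (T y) = rip x y.
Proof.
move=> isoT x y; have := isoT (x + y).
by rewrite linearD !ripE !isoT (ripC y x) (ripC (T y)); lra.
Qed.

(* AM-GM for the two scalar products in
   [Im <Dg, h> + Im <Dh, f> = Im <Dg, h> - Im <Th, Df>],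
   where [D = T - 1] and [h = g - f]. *)
Lemma support_bound_real (T : {linear V -> V}) (c s r : R) (f g : V) :
  (forall x, rip (T x) (T x) = rip x x) -> 0 < c -> s ^+ 2 <= r * c ->
  c * (rip (T f) f + rip (T g) g)
    + s * (rip (T g) ('i%C *: g) - rip (T f) ('i%C *: f)) + 2 * r * rip g f
  <= (c + r) * (rip f f + rip g g).
Proof.
move=> isoT c0 sr; rewrite -(ler_pM2l c0) -subr_ge0.
have iso := isometry_rip isoT.
pose h := g - f.
(* The right side minus the left, multiplied by [c], is half the sum of the first two squares plus
   the third term. *)
have sq1 := rip_ge0 (c%:C%C *: (T g - g) - s%:C%C *: ('i%C *: h)).
have sq2 := rip_ge0 (s%:C%C *: T h + c%:C%C *: ('i%C *: (T f - f))).
have sq3 : 0 <= (r * c - s ^+ 2) * rip h h.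
  by rewrite mulr_ge0 ?rip_ge0 // subr_ge0.
have isoi x y : rip (T x) ('i%C *: T y) = rip x ('i%C *: y).
  by rewrite -linearZ iso.
have skew x : rip x ('i%C *: x) = 0.
  by have := rip_il x x; rewrite ripC; lra.
have i_swap x y : rip x ('i%C *: y) = - rip y ('i%C *: x).
  by rewrite -rip_il ripC.
(* Each scalar product gets one fixed orientation, so that the remaining inequality is linear in the
   atoms. *)
have sym := (ripC f g, ripC f (T f), ripC f (T g), ripC g (T f), ripC g (T g)).
have swap := (i_swap f g, i_swap f (T f), i_swap f (T g), i_swap g (T f),
  i_swap g (T g)).
move: sq1 sq2 sq3; rewrite /h !(linearB T) ?(scalerBr, scalerDr) !ripE.
rewrite !iso !isoi !skew !sym !swap.
by lra.
Qed.

End RealInnerProduct.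

(** * The quadratic form of the operator and its supporting half-planes *)

Section Foguel.
Variables (R : realType) (V : lmodType R[i]) (ip : {dot V for Num.conj}).
Variables (T Ts : {linear V -> V}) (a : R[i]).

Local Notation quad x :=
  (dsum_ip ip ip (foguel T Ts (fun y : V => a *: y) x) x).

Hypothesis adjT : is_adjoint ip T Ts.

(** The adjoint relation eliminates [Ts], so later estimates involve [T] alone. *)
Lemma foguel_quadE f g :
  quad (f, g) = Num.conj (ip (T f) f) + a * ip g f + ip (T g) g.
Proof.
by rewrite /dsum_ip /= linearDl linearZl_LR /= (ipC ip f (Ts f)) -adjT.
Qed.

Lemma ip_unit_scale (u : R[i]) x y :
  `|u| = 1 -> ip (u *: x) (u *: y) = ip x y.
Proof.
move=> u1; rewrite linearZl_LR linearZr_LR /= mulrA conjCE.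
by rewrite -sqr_normc u1 expr1n mul1r.
Qed.

Lemma support_bound (c s r : R) (x : V * V) :
  (forall y, rip ip (T y) (T y) = rip ip y y) ->
  0 < r -> `|a| = (2 * r)%:C%C ->
  c ^+ 2 + s ^+ 2 = 1 -> 0 < c -> s ^+ 2 <= r * c ->
  complex.Re ((c -i* s)%C * quad x)
    <= (c + r) * (rip ip x.1 x.1 + rip ip x.2 x.2).
Proof.
case: x => f g isoT r0 aE cs c0 sr; rewrite foguel_quadE /=.
have r2 : (2 * r)%:C%C != 0 :> R[i].
  by rewrite eq_complex /= negb_and lt0r_neq0 //; lra.
(* Replacing [g] by [u *: g] absorbs the phases of [a] and of [c - i s] in the cross term and leaves
   the terms in [g] alone unchanged. *)
pose u := (c -i* s)%C * (a / (2 * r)%:C%C).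
have u1 : `|u| = 1.
  have r2_ge0 : 0 <= (2 * r)%:C%C :> R[i] by rewrite ler0c; lra.
  rewrite normrM normf_div aE (ger0_norm r2_ge0).
  by rewrite divff // mulr1 normc_normr /= sqrrN cs sqrtr1.
have := support_bound_real f (u *: g) isoT c0 sr.
have -> : rip ip (T (u *: g)) (u *: g) = rip ip (T g) g.
  by rewrite linearZ /rip ip_unit_scale.
have -> : rip ip (T (u *: g)) ('i%C *: (u *: g)) = rip ip (T g) ('i%C *: g).
  by rewrite linearZ scalerA (mulrC 'i%C) -scalerA /rip ip_unit_scale.
have -> : rip ip (u *: g) (u *: g) = rip ip g g by rewrite /rip ip_unit_scale.
apply: le_trans; rewrite !rip_ir.
have -> : 2 * r * rip ip (u *: g) f = complex.Re ((c -i* s)%C * (a * ip g f)).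
  have -> : (c -i* s)%C * (a * ip g f) = (2 * r)%:C%C * ip (u *: g) f.
    rewrite linearZl_LR /= /u; move: (2 * r)%:C%C r2 => k k0.
    by move: (c -i* s)%C (ip g f) => w v; field.
  by rewrite /rip; case: (ip (u *: g) f) => p q /=; ring.
rewrite /rip !mulrDr !raddfD /=.
case: (ip (T f) f) (ip (T g) g) => p q [p' q'] /=.
by lra.
Qed.

(** [support_bound] on unit vectors: a half-plane with normal [c + i s], touching the circle of
    radius [r] about 1 at [1 + r (c + i s)]. *)
Lemma numerical_range_le (c s r : R) (z : R[i]) :
  (forall y, rip ip (T y) (T y) = rip ip y y) ->
  0 < r -> `|a| = (2 * r)%:C%C ->
  c ^+ 2 + s ^+ 2 = 1 -> 0 < c -> s ^+ 2 <= r * c ->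
  numerical_range (dsum_ip ip ip) (foguel T Ts (fun y : V => a *: y)) z ->
  complex.Re ((c -i* s)%C * z) <= c + r.
Proof.
move=> isoT r0 aE cs c0 sr [x x1 <-].
apply: le_trans (support_bound x isoT r0 aE cs c0 sr) _.
suff -> : rip ip x.1 x.1 + rip ip x.2 x.2 = 1 by rewrite mulr1.
apply: (@complexI R); rewrite rmorphD /= -!ipxxE.
by rewrite -[LHS]sqrtCK -[sqrtC _]/(ip_norm (dsum_ip ip ip) x) x1 expr1n.
Qed.

(** * Sums of basis vectors and circles in the numerical range *)

Section Shift.
Variable e : nat -> V.
Hypothesis orth_e : forall m n, ip (e m) (e n) = (m == n)%:R.
Hypothesis shift_e : forall n, T (e n) = e n.+1.

Lemma ip_sum (c d : nat -> R[i]) (x y : nat -> V) m n :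
  ip (\sum_(i < m) c i *: x i) (\sum_(j < n) d j *: y j)
  = \sum_(i < m) \sum_(j < n) c i * Num.conj (d j) * ip (x i) (y j).
Proof.
rewrite linear_sumlz; apply: eq_bigr => i _ /=.
rewrite linear_sumr; apply: eq_bigr => j _.
by rewrite linearZl_LR linearZr_LR /= mulrA.
Qed.

Lemma ip_isometry_on_span (c : nat -> R[i]) n (x := \sum_(k < n) c k *: e k) :
  ip (T x) (T x) = ip x x.
Proof.
rewrite {}/x (linear_sum T); under eq_bigr do rewrite linearZ /= shift_e.
rewrite (ip_sum c c (e \o succn) (e \o succn)) (ip_sum c c e e).
by do 2!apply: eq_bigr => ? _; rewrite !orth_e.
Qed.

Local Notation E n := (\sum_(k < n) e k).

Lemma ip_basis_sum k n : ip (e k) (E n) = (k < n)%:R.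
Proof.
elim: n => [|n IHn]; first by rewrite big_ord0 linear0r.
rewrite big_ord_recr linearDr /= IHn orth_e -natrD ltnS [in RHS]leq_eqVlt.
by case: ltngtP.
Qed.

Lemma ip_sum_sum n : ip (E n) (E n) = n%:R.
Proof.
rewrite linear_sumlz /=.
under eq_bigr do rewrite ip_basis_sum ltn_ord.
by rewrite sumr_const card_ord.
Qed.

(** The shift pushes the last basis vector out of the sum, so [n] of the [n + 1] terms survive. *)
Lemma ip_shift_sum_sum n : ip (T (E n.+1)) (E n.+1) = n%:R.
Proof.
rewrite (linear_sum T) linear_sumlz /=.
under eq_bigr do rewrite shift_e ip_basis_sum ltnS.
rewrite big_ord_recr /= ltnn addr0; under eq_bigr do rewrite ltn_ord.
by rewrite sumr_const card_ord.
Qed.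

(** For a vector [(f, v *: f)] with [v] unimodular the diagonal terms do not depend on [v], while
    the cross term rotates with it and sweeps out the circle. *)
Lemma numerical_range_circle (n : nat) (r : R) (u : R[i]) :
  0 < r -> `|a| = (2 * r)%:C%C -> `|u| = 1 ->
  numerical_range (dsum_ip ip ip) (foguel T Ts (fun y : V => a *: y))
    ((1 - n.+1%:R^-1)%:C%C + r%:C%C * u).
Proof.
(* This scaling gives [f] squared norm 1/2, so that the pair [(f, v *: f)] is a unit vector. *)
move=> r0 aE u1; pose p : R := Num.sqrt ((2 * n.+1%:R)^-1).
have n0 : n.+1%:R != 0 :> R by rewrite pnatr_eq0.
have pp : p * p * n.+1%:R = 2^-1.
  by rewrite -expr2 sqr_sqrtr ?invr_ge0 ?mulr_ge0 //; field.
have pn : p * p * n%:R = 2^-1 - 2^-1 * n.+1%:R^-1.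
  by rewrite -[RHS]opprB -pp mulfK // -[n%:R](addrK 1) natr1; ring.
have r2 : (2 * r)%:C%C != 0 :> R[i].
  by rewrite eq_complex /= negb_and lt0r_neq0 //; lra.
(* Chosen so that [a * v = 2 r u]. *)
pose v := u * Num.conj a / (2 * r)%:C%C.
have v1 : `|v| = 1.
  rewrite normf_div normrM norm_conjC u1 mul1r aE.
  by rewrite (ger0_norm (_ : 0 <= (2 * r)%:C%C)) ?divff // ler0c; lra.
have av : a * v = (2 * r)%:C%C * u.
  have : a * Num.conj a = (2 * r)%:C%C ^+ 2 by rewrite -normCK aE.
  rewrite /v; move: (2 * r)%:C%C r2 (Num.conj a) => k k0 b ab.
  by rewrite mulrA (mulrCA a u) ab; field.
have pC : Num.conj p%:C%C = p%:C%C by rewrite conjCE conjc_real.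
pose f := p%:C%C *: E n.+1.
have ff : ip f f = 2^-1.
  rewrite linearZl_LR linearZr_LR /= ip_sum_sum pC mulrA.
  by rewrite -!(rmorph_nat (real_complex R)) -!rmorphM pp fmorphV.
have Tff : ip (T f) f = (2^-1 - 2^-1 * n.+1%:R^-1)%:C%C.
  by rewrite [T f]linearZ linearZl_LR linearZr_LR /= ip_shift_sum_sum pC mulrA
    -(rmorph_nat (real_complex R)) -!rmorphM pn.
rewrite /numerical_range /=; exists (f, v *: f); rewrite /=.
  rewrite /ip_norm -[X in sqrtC X]/(ip f f + ip (v *: f) (v *: f)).
  by rewrite ip_unit_scale // ff (_ : 2^-1 + 2^-1 = 1) ?sqrtC1 //; field.
apply: etrans (foguel_quadE _ _) _.
rewrite [T (v *: f)]linearZ /= ip_unit_scale // linearZl_LR /= Tff ff.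
rewrite conjCE conjc_real mulrA av.
rewrite !(rmorphB, rmorphM, fmorphV, rmorph_nat, rmorph1) /=.
by move: (n.+1%:R^-1) (r%:C%C) => k q; field.
Qed.

End Shift.
End Foguel.

(** * The shift as an isometry, and the final contradiction *)

(** Norms are preserved on the span of the basis, because an orthonormal family goes to an
    orthonormal family. By continuity the vectors of preserved norm form a closed set, and the span
    is dense. *)
Lemma isometry_of_shift (R : realType) (H : normedModType R[i])
    (ip : {dot H for Num.conj}) (e : nat -> H) (T : {linear H -> H}) :
  (forall x : H, `|x| = ip_norm ip x) -> is_orthonormal_basis ip e ->
  continuous T -> (forall n, T (e n) = e n.+1) ->
  forall x, rip ip (T x) (T x) = rip ip x x.
Proof.
move=> normE [orth_e dense_e] contT shiftT x.
suff : [set y : H | `|T y| - `|y| = 0] x.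
  move=> /= /eqP; rewrite subr_eq0 => /eqP nx.
  apply: (@complexI R); rewrite -!ipxxE -[LHS]sqrtCK -[RHS]sqrtCK.
  by rewrite -!/(ip_norm ip _) -!normE nx.
have closedA : closed [set y : H | `|T y| - `|y| = 0].
  have -> : [set y : H | `|T y| - `|y| = 0]
      = (fun y => `|T y| - `|y|) @^-1` [set 0] by [].
  have cont : continuous (fun y => `|T y| - `|y| : R[i]^o).
    move=> y; apply: cvgB; last exact: norm_continuous.
    by apply: continuous_comp; [exact: contT | exact: norm_continuous].
  apply: (preimage_closed (fun y _ => cont y)).
  exact/accessible_closed_set1/hausdorff_accessible/norm_hausdorff.
rewrite closure_id in closedA; rewrite closedA.
have : closure [set x : H | exists (n : nat) (c : nat -> R[i]),
  x = \sum_(k < n) c k *: e k] x by rewrite dense_e.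
apply: closure_subset => _ [n [c ->]] /=.
by rewrite !normE /ip_norm (ip_isometry_on_span orth_e shiftT) subrr.
Qed.

Theorem mainTheorem2 (R : realType) (H : completeNormedModType R[i])
    (ip : {dot H for Num.conj}) (norm_ip : forall x : H, `|x| = ip_norm ip x)
    (e : nat -> H) (basis_e : is_orthonormal_basis ip e)
    (S Ss : {linear H -> H}) (cont_S : continuous S)
    (shift_S : forall n : nat, S (e n) = e n.+1)
    (adj_S : is_adjoint ip S Ss)
    (a : R[i]) (a_neq0 : a != 0) :
  ~ is_elliptical_disk
      (numerical_range (dsum_ip ip ip)
         (foguel S Ss (fun x : H => a *: x))).
Proof.
set W := numerical_range _ _ => -[f1 [f2 [l [f12 lo hi]]]].
pose r : R := normc a / 2.
have r0 : 0 < r by rewrite divr_gt0 // -ltcR -normc_normr normr_gt0.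
have aE : `|a| = (2 * r)%:C%C by rewrite normc_normr /r mulrC divfK.
have isoS := isometry_of_shift norm_ip basis_e cont_S shift_S.
have [orth_e _] := basis_e.
have l0 : 0 < l.
  by move: f12; rewrite normc_normr ltcR; apply: le_lt_trans (normc_ge0 _).
have {}hi z : W z -> normc (z - f1) + normc (z - f2) <= l.
  by move=> /hi /=; rewrite !normc_normr -rmorphD /= lecR.
have {}lo z : normc (z - f1) + normc (z - f2) < l -> W z.
  by move=> zl; apply: lo; rewrite /= !normc_normr -rmorphD /= ltcR.
have circleW n u : normc u = 1 -> W ((1 - n.+1%:R^-1)%:C%C + r%:C%C * u).
  move=> u1; apply: (numerical_range_circle adj_S orth_e shift_S) => //.
  by rewrite normc_normr u1.
(* Limit of the circles in [W]: moving the centre by [1 / (n + 1)] changes each of the two focal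
   distances by at most that much, hence the bound [d / 2]. *)
have circle u : normc u = 1 ->
    normc (1 + r%:C%C * u - f1) + normc (1 + r%:C%C * u - f2) <= l.
  move=> u1; apply/ler_addgt0Pr => d d0.
  have [n] : exists n, 0 + n.+1%:R^-1 < d / 2 by apply: ltr_add_invr; lra.
  rewrite add0r => nd; have := hi _ (circleW n u u1).
  set z := ((1 - n.+1%:R^-1)%:C%C + r%:C%C * u) => zl.
  have dist f : normc (1 + r%:C%C * u - f) <= normc (z - f) + n.+1%:R^-1.
    have -> : 1 + r%:C%C * u - f = (z - f) + (n.+1%:R^-1)%:C%C.
      by rewrite /z rmorphB rmorph1; ring.
    apply: le_trans (le_normcD _ _) _.
    by rewrite normc_real ger0_norm // invr_ge0.
  apply: le_trans (lerD (dist f1) (dist f2)) _.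
  by rewrite addrACA lerD // [leRHS]splitr lerD // ltW.
have arc c s : c ^+ 2 + s ^+ 2 = 1 -> 0 < c -> s ^+ 2 <= r * c ->
    normc (1 + r%:C * (c +i* s) - f1)%C + normc (1 + r%:C * (c +i* s) - f2)%C
      = l.
  move=> cs c0 sr; set w := (c +i* s)%C.
  have w1 : normc w = 1 by rewrite /= cs sqrtr1.
  apply/eqP; rewrite eq_le circle //= leNgt; apply/negP => lt_l.
  (* A quarter of the slack: moving outwards by [d] costs at most [2 d], half the slack, so the new
     point is still in [W], but beyond the half-plane with normal [w]. *)
  pose d := (l - (normc (1 + r%:C%C * w - f1)
    + normc (1 + r%:C%C * w - f2))) / 4.
  have d0 : 0 < d by rewrite /d; lra.
  have dist f :
      normc (1 + (r + d)%:C%C * w - f) <= normc (1 + r%:C%C * w - f) + d.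
    have -> : 1 + (r + d)%:C%C * w - f = (1 + r%:C%C * w - f) + d%:C%C * w.
      by rewrite rmorphD; ring.
    apply: le_trans (le_normcD _ _) _.
    by rewrite normcM normc_real w1 mulr1 gtr0_norm.
  have : W (1 + (r + d)%:C%C * w).
    apply/lo/(le_lt_trans (lerD (dist f1) (dist f2))).
    by rewrite addrACA -ltrBrDl /d; lra.
  move=> /(numerical_range_le adj_S isoS r0 aE cs c0 sr).
  have -> : complex.Re ((c -i* s)%C * (1 + (r + d)%:C%C * w))
      = c + (r + d) * (c ^+ 2 + s ^+ 2) by rewrite /w /=; ring.
  by rewrite cs; lra.
have [f1E f2E lE] := ellipse_through_arc r0 l0 arc.
have N1 : normc (-1 : R[i]) = 1 by rewrite normcN normc1.
(* With [n = 0] the circle is centred at 0 and contains [-r], whose distance [r + 1] from the double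
   focus 1 exceeds [l / 2 = r]. *)
have := hi _ (circleW 0%N (-1) N1); rewrite f1E f2E lE.
have -> : (1 - 1%:R^-1)%:C%C + r%:C%C * -1 - 1 = (- (r + 1))%:C%C :> R[i].
  by rewrite invr1 subrr rmorphN rmorphD rmorph1 rmorph0; ring.
by rewrite normc_real normrN gtr0_norm; lra.
Qed.
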